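(* Let $F\in\mathbb{Z}_{\ge0}$, $n\ge 2$, $1\le k\le n-1$, let $\mathcal{D}=C_n\{1,2,\dots,k\}=(\mathcal{V},\mathcal{E})$ be the $k$-circulant digraph on $n$ agents, and let $\mathcal{L}\subset\mathcal{V}$ be a set of leaders. (1) If $\mathcal{D}$ contains a set $P_L\subseteq\mathcal{V}$ of agents consecutive by index such that $|P_L|\le k$ and $|P_L\cap\mathcal{L}|\ge 2F+1$, then $\mathcal{D}$ is strongly $(2F+1)$-robust with respect to $\mathcal{L}$. (2) If $\mathcal{D}$ contains a set $P_L\subseteq\mathcal{V}$ of agents consecutive by index such that $|P_L|\le k-F$ and $|P_L\cap\mathcal{L}|\ge F+1$, then $\mathcal{D}$ is trusted leader-follower (TLF) robust with parameter $F$ (with respect to the set $S=\mathcal{L}$).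
   Context: The $k$-circulant digraph $C_n\{1,2,\dots,k\}$ has vertex set $\mathcal{V}=\{1,\dots,n\}$ (indices taken modulo $n$) and directed edges $(i,(i+a)\bmod n)$ for all $i\in\mathcal{V}$ and $a\in\{1,\dots,k\}$. An edge $(j,i)$ means $j$ is an in-neighbor of $i$; $\mathcal{V}_i=\{j:(j,i)\in\mathcal{E}\}$. A set of agents consecutive by index is a set of the form $\{a+1,a+2,\dots,a+m\}$ with indices taken modulo $n$ (e.g. $\{14,15,1,2\}$ for $n=15$). A nonempty set $C\subseteq\mathcal{V}$ is $r$-reachable if there is $i\in C$ with $|\mathcal{V}_i\setminus C|\ge r$. A graph is strongly $r$-robust with respect to $S\subset\mathcal{V}$ if every nonempty $C\subseteq\mathcal{V}\setminus S$ is $r$-reachable. A graph is TLF robust with parameter $F$ (with respect to $S\subset\mathcal{V}$) if for every nonempty $C\subseteq\mathcal{V}\setminus S$ at least one of the following holds: (i) there exists $i\in C$ with $|\mathcal{V}_i\cap S|\ge F+1$; (ii) $C$ is $(2F+1)$-reachable. *)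

(* Defs.v *)
From mathcomp Require Import all_boot.

Set Implicit Arguments.
Unset Strict Implicit.
Unset Printing Implicit Defensive.

(* A digraph is given by its edge relation: [e j i] means that (j, i) is an
   edge, i.e. that j is an in-neighbor of i. *)
Section Robustness.

Variables (V : finType) (e : rel V).
Implicit Types (C S : {set V}) (i : V) (r F : nat).

Definition in_neighbors i : {set V} := [set j | e j i].

Definition reachable r C : Prop :=
  exists2 i : V, i \in C & r <= #|in_neighbors i :\: C|.

Definition strongly_robust r S : Prop :=
  forall C, C != set0 -> C \subset ~: S -> reachable r C.

Definition TLF_robust F S : Prop :=
  forall C, C != set0 -> C \subset ~: S ->
    (exists2 i : V, i \in C & F + 1 <= #|in_neighbors i :&: S|)
    \/ reachable (2 * F + 1) C.

End Robustness.

(* Agents are labelled by the residues 0, ..., n - 1 modulo n, so that the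
   agent usually numbered n is the element 0 of ['I_n]. The ordinals
   [a : 'I_k] and [t : 'I_m] below range over 0, ..., k - 1 and 0, ..., m - 1;
   their successors are the offsets 1, ..., k and 1, ..., m. *)
Definition circulant (n k : nat) : rel 'I_n :=
  fun i j => [exists a : 'I_k, j == i + a.+1 %[mod n]].

Definition consecutive (n : nat) (P : {set 'I_n}) : Prop :=
  exists a m : nat, P = [set i : 'I_n | [exists t : 'I_m, i == a + t.+1 %[mod n]]].

(* Main.v *)
(** Slide a window of [k < n] consecutive agents one step at a time, each window
being the in-neighborhood of the agent that follows it. As long as that agent
is outside [C], a step loses at most one agent outside [C] and gains exactly
one, so the number of agents outside [C] in the window never decreases, and the
window eventually stops right before an agent of [C]. For (1), start at the
window beginning with [P_L]. For (2), either one of the agents following [P_L]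
at distance at most [F] lies in [C], and it sees all leaders of [P_L],
or they provide [F] further agents outside [C] in that window. *)

Require Import Defs.
From mathcomp Require Import all_boot zmodp.

Set Implicit Arguments.
Unset Strict Implicit.
Unset Printing Implicit Defensive.

Section Arcs.

Variable n : nat.
Implicit Types (a b k m r t : nat) (C : {set 'I_n.+1}).

(** The start [b] is any natural number, reduced only by [inZp], so wrap-around needs no case split.
    As [b] itself is left out, the window seen by agent [b + k + 1] is exactly [arc b k]. *)
Definition arc b m : {set 'I_n.+1} := [set inZp (b + t.+1) | t : 'I_m].

Lemma arcP b m j :
  reflect (exists2 t, t < m & j = inZp (b + t.+1)) (j \in arc b m).
Proof.
apply: (iffP imsetP) => [[t _ ->]|[t tm ->]]; first by exists t; rewrite ?ltn_ord.
by exists (Ordinal tm).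
Qed.

Lemma arc_recr b m : arc b m.+1 = inZp (b + m.+1) |: arc b m.
Proof.
apply/setP=> j; rewrite in_setU1; apply/arcP/predU1P => [[t]|[->|/arcP[t tm ->]]].
- rewrite ltnS leq_eqVlt => /predU1P[->|tm] ->; first by left.
  by right; apply/arcP; exists t.
- by exists m.
- by exists t => //; apply: ltnW.
Qed.

Lemma arc_recl b m : arc b m.+1 = inZp b.+1 |: arc b.+1 m.
Proof.
apply/setP=> j; rewrite in_setU1.
apply/arcP/predU1P => [[[|t] tm ->]|[->|/arcP[t tm ->]]].
- by left; rewrite addn1.
- by right; apply/arcP; exists t; rewrite // addSnnS.
- by exists 0; rewrite // addn1.
- by exists t.+1; rewrite // addSnnS.
Qed.

Lemma arc_subset b m m' : m <= m' -> arc b m \subset arc b m'.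
Proof.
move=> le_mm'; apply/subsetP=> j /arcP[t tm ->]; apply/arcP.
by exists t => //; apply: leq_trans tm le_mm'.
Qed.

Lemma card_arc b m : m <= n.+1 -> #|arc b m| = m.
Proof.
move=> le_mn; rewrite card_imset ?card_ord // => s t /(congr1 val) /= /eqP.
rewrite eqn_modDl -[s.+1]add1n -[t.+1]add1n eqn_modDl.
by rewrite !modn_small ?(leq_trans (ltn_ord _) le_mn) // => /eqP/val_inj.
Qed.

(** The length in [consecutive] is unbounded, so an arc may overlap itself and have fewer than [m]
    elements. For [m > n + 1] it contains a full turn, hence at least [n + 1 > k] agents. *)
Lemma leq_of_card_arc b m k : k <= n -> #|arc b m| <= k -> m <= k.
Proof.
move=> le_kn; case: (leqP m n.+1) => [/card_arc-> //|/ltnW lt_nm].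
have := subset_leq_card (arc_subset b lt_nm); rewrite card_arc // => le_n.
by move=> /(leq_trans le_n); rewrite ltnNge le_kn.
Qed.

Lemma consecutive_arc (P : {set 'I_n.+1}) :
  consecutive P -> exists a m, P = arc a m.
Proof.
case=> a [m ->]; exists a, m; apply/setP=> j; rewrite inE.
apply/existsP/arcP => [[t /eqP jt]|[t tm ->]].
  by exists t; rewrite ?ltn_ord //; apply: val_inj; rewrite /= -jt modn_small.
by exists (Ordinal tm); rewrite /= modn_mod.
Qed.

Lemma card_arcD_recr C b m : m <= n -> inZp (b + m.+1) \notin C ->
  #|arc b m.+1 :\: C| = #|arc b m :\: C|.+1.
Proof.
move=> le_mn xC; have : inZp (b + m.+1) \notin arc b m.
  (* If the new agent were already in the arc, lengths [m] and [m + 1] would give the same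
     cardinality. *)
  apply/negP=> xA; have /eqP := card_arc b (le_mn : m.+1 <= n.+1).
  by rewrite arc_recr (setUidPr _) ?sub1set // card_arc ?ltn_eqF // ltnW.
rewrite arc_recr setDUl (setDidPl _) ?disjoints1 // => xA.
by rewrite cardsU1 inE negb_and xA orbT.
Qed.

Lemma leq_card_arcD C b m t :
    m + t <= n.+1 -> (forall s, s < t -> inZp (b + m + s.+1) \notin C) ->
  #|arc b m :\: C| + t <= #|arc b (m + t) :\: C|.
Proof.
elim: t => [|t IHt] le_n outC; first by rewrite !addn0.
rewrite !addnS card_arcD_recr; first 1 last.
- by rewrite addnS in le_n.
- by rewrite -addnS addnA outC.
rewrite ltnS IHt //; first by rewrite (leq_trans _ le_n) // leq_add2l.
by move=> s /ltnW; apply: outC.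
Qed.

(** Both windows lie in [arc b k.+1], which has exactly one more agent outside [C] than the first
    and at most one more than the second. *)
Lemma leq_card_arcD_shift C b k : k <= n -> inZp (b + k.+1) \notin C ->
  #|arc b k :\: C| <= #|arc b.+1 k :\: C|.
Proof.
move=> le_kn /(card_arcD_recr le_kn); rewrite arc_recl setDUl => cardA.
rewrite -ltnS -cardA (leq_trans (leq_card_setU _ _)) // -[leqRHS]add1n leq_add2r.
by have := subset_leq_card (subsetDl [set inZp b.+1 : 'I_n.+1] C); rewrite cards1.
Qed.

Lemma arc_sub_in_neighbors b m t k : m + t <= k ->
  arc b m \subset in_neighbors (@circulant n.+1 k) (inZp (b + m + t.+1)).
Proof.
move=> le_k; apply/subsetP=> j /arcP[s lt_sm ->]; rewrite inE.
(* The offset from [b + s + 1] to [b + m + t + 1] is [m - s + t]; [circulant] is indexed by its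
   predecessor. *)
have lt_k : m - s.+1 + t < k.
  by apply: leq_trans le_k; rewrite ltn_add2r ltn_subrL (leq_ltn_trans _ lt_sm).
apply/existsP; exists (Ordinal lt_k); rewrite /= modn_mod modnDml.
by rewrite -addnS addnA -(addnA b s.+1) subnKC.
Qed.

Lemma reachable_of_arc C r b k : k <= n -> C != set0 ->
  r <= #|arc b k :\: C| -> reachable (@circulant n.+1 k) r C.
Proof.
move=> le_kn /set0Pn[x xC] le_r.
have : exists s, inZp (b + s + k.+1) \in C.
  (* Modulo [n + 1], adding [n] times [b + k + 1] subtracts it, without truncation. *)
  exists (x + (b + k.+1) * n); rewrite addnAC addnCA -mulnS.
  suff -> : inZp (x + (b + k.+1) * n.+1) = x by [].
  by apply: val_inj; rewrite /= addnC modnMDl modn_small.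
(* Minimality puts the agent after each earlier window outside [C], as every shift requires. *)
case/ex_minnP=> s sC min_s; exists (inZp (b + s + k.+1)) => //.
have := @arc_sub_in_neighbors (b + s) k 0 k.
rewrite addn0 addn1 -addnS => /(_ (leqnn k)) sub_s.
apply: leq_trans (subset_leq_card (setSD _ sub_s)).
have : forall t, t < s -> inZp (b + t + k.+1) \notin C.
  by move=> t; rewrite ltnNge; apply: contra => /min_s.
elim: (s) => [|t IHt] outC; first by rewrite addn0.
rewrite addnS (leq_trans (IHt _)) //; first by move=> u /ltnW; apply: outC.
by rewrite leq_card_arcD_shift ?outC.
Qed.

End Arcs.

Theorem theorem3 (F n k : nat) (hn : 2 <= n) (hk1 : 1 <= k) (hkn : k <= n - 1)
    (L : {set 'I_n}) :
  ((exists P : {set 'I_n},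
      [/\ consecutive P, #|P| <= k & 2 * F + 1 <= #|P :&: L| ]) ->
   strongly_robust (@circulant n k) (2 * F + 1) L)
  /\
  ((exists P : {set 'I_n},
      [/\ consecutive P, #|P| + F <= k & F + 1 <= #|P :&: L| ]) ->
   TLF_robust (@circulant n k) F L).
Proof.
case: n hn hkn L => // n _; rewrite subn1 /= => le_kn L.
have leaders_out (P C : {set 'I_n.+1}) : C \subset ~: L ->
    #|P :&: L| <= #|P :\: C|.
  by move=> CL; rewrite setDE subset_leq_card // setIS // subsetC.
split=> -[_ [/consecutive_arc[a [m ->]] le_k le_F]] C C0 CL.
  have le_mk : m <= k by apply: leq_of_card_arc le_k.
  apply: (reachable_of_arc (b := a)) => //.
  apply: leq_trans (subset_leq_card (setSD C (arc_subset _ _ le_mk))).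
  exact: leq_trans le_F (leaders_out _ _ CL).
have le_mk : m <= k - F.
  apply: (leq_of_card_arc (b := a)); first exact: leq_trans (leq_subr _ _) le_kn.
  by rewrite leq_subRL ?(leq_trans _ le_k) ?leq_addl // addnC.
have le_mFk : m + F <= k.
  by rewrite addnC -leq_subRL // (leq_trans _ le_k) ?leq_addl.
have [[t tC]|outC] := altP (@existsP 'I_F (fun t => inZp (a + m + t.+1) \in C)).
  (* Since [t < F], this agent is at most [m + t <= k] steps ahead of any agent of the arc. *)
  left; exists (inZp (a + m + t.+1)) => //; apply: leq_trans le_F _.
  rewrite subset_leq_card // setSI // arc_sub_in_neighbors //.
  by rewrite (leq_trans _ le_mFk) // leq_add2l ltnW.
right; apply: (reachable_of_arc (b := a)) => //.
apply: leq_trans (subset_leq_card (setSD _ (arc_subset _ _ le_mFk))).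
(* Of the [2 * F + 1] agents, [F + 1] are leaders in [arc a m] and [F] come from its extension. *)
apply: leq_trans (leq_card_arcD _ _); last first.
- by move=> s lt_sF; have := outC; rewrite negb_exists => /forallP/(_ (Ordinal lt_sF)).
- by rewrite (leq_trans le_mFk) // leqW.
rewrite mul2n -addnn addnAC leq_add2r.
exact: leq_trans le_F (leaders_out _ _ CL).
Qed.
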